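(* Let $\Lambda$ be a finite dimensional eventually periodic algebra over a field $k$. Then both $\Lambda$ and its opposite algebra $\Lambda^{\mathrm{op}}$ satisfy condition (AC).
   Context: Rings are associative and unital; modules are left modules. An algebra $A$ satisfies (AC) if for every finitely generated $A$-module $M$ there exists an integer $b_M\ge 0$ such that, for every finitely generated $A$-module $N$: if $\operatorname{Ext}_A^i(M,N)=0$ for all sufficiently large $i$, then $\operatorname{Ext}_A^i(M,N)=0$ for all $i>b_M$. $\Lambda^{\mathrm e}=\Lambda\otimes_k\Lambda^{\mathrm{op}}$; $\Lambda^{\mathrm e}$-modules are identified with $\Lambda$-bimodules on which $k$ acts centrally. For a finite dimensional algebra $A$ and an $A$-module $M$, the syzygy $\Omega_A(M)$ is the kernel of a projective cover of $M$, $\Omega_A^0(M)=M$ and $\Omega_A^n(M)=\Omega_A(\Omega_A^{n-1}(M))$. $M$ is periodic if $\Omega_A^p(M)\cong M$ as $A$-modules for some $p>0$, and eventually periodic if $\Omega_A^n(M)$ is periodic for some $n\ge 0$. The algebra $\Lambda$ is eventually periodic if the regular bimodule $\Lambda$ is eventually periodic as a $\Lambda^{\mathrm e}$-module. *)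

(* Defs.v *)
From HB Require Import structures.
From mathcomp Require Import all_boot all_algebra all_field.

Set Implicit Arguments.
Unset Strict Implicit.
Unset Printing Implicit Defensive.

Import GRing.Theory.
Local Open Scope ring_scope.

Definition surj (X Y : Type) (f : X -> Y) : Prop := forall y, exists x, f x = y.

(* Modules over a ring.  Right modules are left modules over R^c. *)

Definition finitely_generated (R : pzRingType) (M : lmodType R) : Prop :=
  exists (n : nat) (e : 'I_n -> M), forall m : M,
    exists a : 'I_n -> R, m = \sum_(i < n) a i *: e i.

Definition projective (R : pzRingType) (P : lmodType R) : Prop :=
  forall (X Y : lmodType R) (g : {linear X -> Y}) (f : {linear P -> Y}),
    surj g -> exists h : {linear P -> X}, forall x, g (h x) = f x.

(* ... -> res 2 -> res 1 -> res 0 -> M -> 0, with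
   res_d i : res i.+1 -> res i. *)
Record projective_resolution (R : pzRingType) (M : lmodType R) :=
  ProjectiveResolution {
    res :> nat -> lmodType R;
    res_d : forall i, {linear res i.+1 -> res i};
    res_aug : {linear res 0 -> M};
    res_projective : forall i, projective (res i);
    res_aug_surj : surj res_aug;
    res_aug_exact : forall x, res_aug x = 0 <-> exists y, res_d 0 y = x;
    res_d_exact : forall i x, res_d i x = 0 <-> exists y, res_d i.+1 y = x
  }.

Section Ext.
Variables (R : pzRingType) (M N : lmodType R) (P : projective_resolution M).

Definition cocycle (i : nat) (f : {linear P i -> N}) : Prop :=
  forall x, f (res_d P i x) = 0.

Definition coboundary (i : nat) : {linear P i -> N} -> Prop :=
  match i return {linear P i -> N} -> Prop with
  | 0 => fun f => forall x, f x = 0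
  | j.+1 => fun f => exists g : {linear P j -> N}, forall x, f x = g (res_d P j x)
  end.

End Ext.

(* Ext^i_R(M, N) = H^i(Hom_R(P, N)) vanishes; as usual, the choice of the
   projective resolution P of M is immaterial. *)
Definition Ext_vanishes (R : pzRingType) (i : nat) (M N : lmodType R) : Prop :=
  exists P : projective_resolution M,
    forall f : {linear P i -> N}, cocycle f -> coboundary f.

Definition satisfies_AC (R : pzRingType) : Prop :=
  forall M : lmodType R, finitely_generated M ->
  exists b : nat, forall N : lmodType R, finitely_generated N ->
    (exists m : nat, forall i : nat, (m <= i)%N -> Ext_vanishes i M N) ->
    forall i : nat, (b < i)%N -> Ext_vanishes i M N.

(* Modules over the enveloping algebra A^e = A (x)_k A^op, in the form of
   A-bimodules on which k acts centrally; A^e-linear maps are the maps that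
   are linear on both sides. *)

HB.mixin Record Lmodule_isBimodule (k : fieldType) (A : algType k) B
    & GRing.Lmodule A B := {
  ract : B -> A -> B;
  ractDl : forall (x y : B) (a : A), ract (x + y) a = ract x a + ract y a;
  ractDr : forall (x : B) (a b : A), ract x (a + b) = ract x a + ract x b;
  ract1 : forall x : B, ract x 1 = x;
  ractM : forall (x : B) (a b : A), ract x (a * b) = ract (ract x a) b;
  ractZ : forall (a : A) (x : B) (b : A), ract (a *: x) b = a *: ract x b;
  ract_central : forall (c : k) (x : B), ract x (c%:A : A) = (c%:A : A) *: x
}.

#[short(type="bimodType")]
HB.structure Definition Bimodule (k : fieldType) (A : algType k) :=
  { B of GRing.Lmodule A B & Lmodule_isBimodule k A B }.

Section RegularBimodule.
Variables (k : fieldType) (A : algType k).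

Let regular_ract (x : A^o) (a : A) : A^o := (x : A) * a.

Let regular_ractDl (x y : A^o) a :
  regular_ract (x + y) a = regular_ract x a + regular_ract y a.
Proof. exact: mulrDl. Qed.

Let regular_ractDr (x : A^o) a b :
  regular_ract x (a + b) = regular_ract x a + regular_ract x b.
Proof. exact: mulrDr. Qed.

Let regular_ract1 (x : A^o) : regular_ract x 1 = x.
Proof. exact: mulr1. Qed.

Let regular_ractM (x : A^o) a b :
  regular_ract x (a * b) = regular_ract (regular_ract x a) b.
Proof. exact: mulrA. Qed.

Let regular_ractZ a (x : A^o) b :
  regular_ract (a *: x) b = a *: regular_ract x b.
Proof. exact: esym (mulrA _ _ _). Qed.

Let regular_ract_central (c : k) (x : A^o) :
  regular_ract x (c%:A : A) = (c%:A : A) *: x.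
Proof. exact: etrans (mulr_algr _ _) (esym (mulr_algl _ _)). Qed.

HB.instance Definition _ := Lmodule_isBimodule.Build k A A^o
  regular_ractDl regular_ractDr regular_ract1 regular_ractM regular_ractZ
  regular_ract_central.

End RegularBimodule.

Section Bimodules.
Variables (k : fieldType) (A : algType k).
Implicit Types B C K L P : bimodType A.

Definition right_linear B C (f : B -> C) : Prop :=
  forall x a, f (ract x a) = ract (f x) a.

Definition bimod_iso B C : Prop :=
  exists f : {linear B -> C}, right_linear f /\ bijective f.

Definition bimod_projective P : Prop :=
  forall (X Y : bimodType A) (g : {linear X -> Y}) (f : {linear P -> Y}),
    right_linear g -> right_linear f -> surj g ->
    exists h : {linear P -> X}, right_linear h /\ forall x, g (h x) = f x.

Definition subbimodule B (U : B -> Prop) : Prop :=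
  [/\ U 0, forall x y, U x -> U y -> U (x + y),
      forall a x, U x -> U (a *: x) & forall x a, U x -> U (ract x a)].

Definition superfluous B (S : B -> Prop) : Prop :=
  forall U : B -> Prop, subbimodule U ->
    (forall x, exists u s, [/\ U u, S s & x = u + s]) -> forall x, U x.

Definition projective_cover P B (f : {linear P -> B}) : Prop :=
  [/\ bimod_projective P, right_linear f, surj f
    & superfluous (fun x => f x = 0)].

(* K is (isomorphic to) the kernel of a projective cover of B. *)
Definition is_syzygy B K : Prop :=
  exists (P : bimodType A) (f : {linear P -> B}) (j : {linear K -> P}),
    [/\ projective_cover f, right_linear j, injective j
      & forall x, f x = 0 <-> exists y, j y = x].

(* K is isomorphic to Omega^n(B). *)
Fixpoint is_nth_syzygy (n : nat) B K : Prop :=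
  if n is n'.+1 then exists L, is_nth_syzygy n' B L /\ is_syzygy L K
  else bimod_iso B K.

Definition periodic B : Prop :=
  exists (p : nat) K, [/\ (0 < p)%N, is_nth_syzygy p B K & bimod_iso K B].

Definition eventually_periodic B : Prop :=
  exists (n : nat) K, is_nth_syzygy n B K /\ periodic K.

End Bimodules.

Definition eventually_periodic_algebra (k : fieldType) (A : algType k) : Prop :=
  eventually_periodic (A^o : bimodType A).

(* Main.v *)
From HB Require Import structures.
From mathcomp Require Import all_boot all_algebra all_field.
From mathcomp Require Import boolp classical_sets functions.
Require Import Defs.

(** Let A be an algebra over a field k, M and N two A-modules, Q a projective
resolution of M, and K a bimodule.  Everything rests on the cohomology of the
complex of A-linear maps K (x)_A Q_i -> N.  Such a map is the same as a map
K x Q_i -> N that is additive in both variables, commutes with the left action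
of A on K, and moves the right action of A on K across to Q_i: a balanced map
(balanced).  For K = A the complex is Hom_A(Q, N), whose cohomology is
Ext_A(M, N) (balanced_exact_regular).

Dimension shifting in the bimodule variable is the core of the proof
(balanced_exact_shift).  Let 0 -> K -> P -> L -> 0 be exact, with P a projective
bimodule and L projective as a left module.  Then the complex of L is exact in
degree i + 2 iff the complex of K is exact in degree i + 1.  The proof is a
diagram chase that extends balanced maps in two ways:
- along Q_i.+1 -> Q_i, for maps on P x Q_i.+1: P is projective against
  surjections of bimodules Hom_k(Q_i, N) -> Hom_k(Im d_i, N), and these are
  surjections because subspaces of vector spaces over k have complements
  (projective_balanced_extension);
- along K -> P, for maps on K x Q_i: the inclusion splits on the left, so that
  Hom_A(P, N) -> Hom_A(K, N) is a surjection of left modules, and Q_i is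
  projective (left_split_balanced_extension).
Projective bimodules are projective on the left, so the kernel K is again
left projective and the shift can be iterated.

Hence if the n-th syzygy of the bimodule A has period p, then for i > n the
vanishing of Ext^(i + p)(M, N) and of Ext^i(M, N), computed with one and the
same resolution, are equivalent.  If Ext^i(M, N) vanishes for all large i, it
vanishes for all i > n, and the bound n depends neither on M nor on N
(eventually_periodic_AC).

For the opposite algebra, exchange the two actions on every bimodule: this is
an equivalence of bimodule categories that takes the regular bimodule of A to
that of its opposite, so eventual periodicity is inherited
(eventually_periodic_anti). *)

Set Implicit Arguments.
Unset Strict Implicit.
Unset Printing Implicit Defensive.

Import GRing.Theory.
Local Open Scope ring_scope.

(** * Linear maps and vector spaces *)

Definition linear_pack (R : pzRingType) (U V : lmodType R) (f : U -> V)
    (f_lin : linear f) : {linear U -> V} :=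
  HB.pack f (GRing.isLinear.Build R U V *:%R f f_lin).

Lemma linear_of_graph (R : pzRingType) (U V : lmodType R) (G : U -> V -> Prop) :
    (forall x, exists y, G x y) ->
    (forall x y y', G x y -> G x y' -> y = y') ->
    (forall a x x' y y', G x y -> G x' y' -> G (a *: x + x') (a *: y + y')) ->
  exists f : {linear U -> V}, forall x, G x (f x).
Proof.
move=> Gtot Gfun Glin; have [f Gf] := choice Gtot.
have f_lin : linear f.
  by move=> a x y; apply: Gfun (Gf _) _; apply: Glin; apply: Gf.
by exists (linear_pack f_lin).
Qed.

Section VectorSpaces.
Variable k : fieldType.
Implicit Types U V W : lmodType k.

(** A maximal subspace T meeting S trivially is a complement: a vector x outside
S + T could be adjoined to T. *)
Lemma exists_complement V (S : V -> Prop) :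
    S 0 -> (forall c x y, S x -> S y -> S (c *: x + y)) ->
  exists T : V -> Prop,
    [/\ T 0, forall c x y, T x -> T y -> T (c *: x + y),
        forall x, T x -> S x -> x = 0
      & forall x, exists s t, [/\ S s, T t & x = s + t]].
Proof.
move=> S0 SL.
pose good (T : set V) := (forall c x y, T x -> T y -> T (c *: x + y)) /\
  forall x, T x -> S x -> x = 0.
(* The predicate good admits the empty set, the union of the empty chain; the
   maximal T contains 0 all the same (T0 below). *)
have [F Fgood Ftot|T [[TL TS] Tmax]] := @Zorn_bigcup V good.
  split=> [c x y [X FX Xx] [Y FY Yy]|x [X FX Xx]]; last exact: (Fgood X FX).2.
  have [XY|YX] := Ftot _ _ FX FY.
    by exists Y => //; apply: (Fgood Y FY).1 => //; apply: XY.
  by exists X => //; apply: (Fgood X FX).1 => //; apply: YX.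
have maxT T' : good T' -> (forall x, T x -> T' x) -> forall x, T' x -> T x.
  move=> gT' sTT' x T'x; apply: contrapT => nTx; apply: (Tmax T') => //.
  by split=> // /(_ x T'x).
have T0 : T 0.
  apply: (maxT (fun x => T x \/ x = 0)); [split | by left | by right].
    move=> c x y [Tx|->] [Ty|->]; rewrite ?scaler0 ?add0r ?addr0; auto.
    left.
    have -> : c *: x = (c - 1) *: x + x by rewrite scalerBl scale1r subrK.
    exact: TL.
  by move=> x [Tx|-> //]; apply: TS.
exists T; split=> // x; apply: contrapT => nx.
pose T' y := exists c t, T t /\ y = c *: x + t.
have ZT c t : T t -> T (c *: t).
  by move=> Tt; rewrite -[_ *: _]addr0; apply: TL.
have ZS c t : S t -> S (c *: t).
  by move=> St; rewrite -[_ *: _]addr0; apply: SL.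
have Tx : T x.
  apply: (maxT T'); last by exists 1, 0; rewrite scale1r addr0.
    split=> [c _ _ [a [t [Tt ->]]] [b [u [Tu ->]]]|_ [c [t [Tt ->]]] Sy].
      exists (c * a + b), (c *: t + u); split; first exact: TL.
      by rewrite scalerDr scalerA scalerDl addrACA.
    have [c0|c0] := eqVneq c 0.
      by move: Sy; rewrite c0 scale0r add0r => /TS; apply.
    case: nx; exists (c^-1 *: (c *: x + t)), (- c^-1 *: t); split; auto.
    by rewrite scalerDr scalerA mulVf // scale1r scaleNr addrK.
  by move=> t Tt; exists 0, t; rewrite scale0r add0r.
by apply: nx; exists 0, x; rewrite add0r.
Qed.

Lemma linear_section U V (g : {linear U -> V}) :
  surj g -> exists s : {linear V -> U}, cancel s g.
Proof.
move=> g_surj; have [||T [T0 TL TS Tsum]] := @exists_complement U (fun x => g x = 0).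
- exact: linear0.
- by move=> c x y gx gy; rewrite linearP gx gy scaler0 addr0.
have [|||s Gs] := @linear_of_graph k V U (fun y x => T x /\ g x = y).
- move=> y; have [x <-] := g_surj y; have [u [t [gu Tt ->]]] := Tsum x.
  by exists t; rewrite linearD gu add0r.
- move=> _ x x' [Tx <-] [Tx' gx']; apply/eqP; rewrite -subr_eq0; apply/eqP.
  apply: TS; last by rewrite linearB gx' subrr.
  by rewrite addrC -scaleN1r; apply: TL.
- by move=> a x x' y y' [Ty <-] [Ty' <-]; split; [apply: TL | rewrite linearP].
by exists s => y; case: (Gs y).
Qed.

Lemma linear_extension U V W (d : {linear U -> V}) (f : {linear U -> W}) :
    (forall u, d u = 0 -> f u = 0) ->
  exists g : {linear V -> W}, forall u, g (d u) = f u.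
Proof.
move=> ker_df.
have [||T [T0 TL TS Tsum]] := @exists_complement V (fun y => exists u, d u = y).
- by exists 0; apply: linear0.
- by move=> c _ _ [x <-] [y <-]; exists (c *: x + y); rewrite linearP.
(* The extension is f on the image of d and 0 on the complement T. *)
pose G v w := exists u t, [/\ T t, v = d u + t & w = f u].
have TB t t' : T t -> T t' -> T (t' - t).
  by move=> Tt Tt'; rewrite addrC -scaleN1r; apply: TL.
have Gfun v w w' : G v w -> G v w' -> w = w'.
  move=> [u [t [Tt -> ->]]] [u' [t' [Tt' e ->]]].
  have tdu : t' - t = d (u - u').
    by rewrite linearB; apply/eqP; rewrite subr_eq addrAC e [d u' + t']addrC addrK.
  apply/eqP; rewrite -subr_eq0 -linearB; apply/eqP/ker_df; rewrite -tdu.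
  by apply: TS; [apply: TB | exists (u - u')].
have [||g Gg] := @linear_of_graph k V W G _ Gfun.
- move=> v; have [_ [t [[u <-] Tt ->]]] := Tsum v.
  by exists (f u), u, t.
- move=> a x x' y y' [u [t [Tt -> ->]]] [u' [t' [Tt' -> ->]]].
  exists (a *: u + u'), (a *: t + t'); rewrite !linearP; split=> //; first exact: TL.
  by rewrite scalerDr addrACA.
by exists g => u; apply: Gfun (Gg _) _; exists u, 0; rewrite addr0.
Qed.

End VectorSpaces.

(** * Bimodules of k-linear maps *)

Section Bimodules.
Variables (k : fieldType) (A : algType k).
Implicit Types (B C K L P : bimodType A) (M N Q X Y : lmodType A).

Definition over_base M : Type := M.

Section OverBase.
Variable M : lmodType A.
HB.instance Definition _ := GRing.Zmodule.on (over_base M).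

Let base_scale (c : k) (x : over_base M) : over_base M := (c%:A : A) *: (x : M).

Fact base_scaleA c d x : base_scale c (base_scale d x) = base_scale (c * d) x.
Proof. by rewrite /base_scale scalerA -scalerAl mul1r scalerA. Qed.

Fact base_scale1 : left_id 1 base_scale.
Proof. by move=> x; rewrite /base_scale scale1r (scale1r (x : M)). Qed.

Fact base_scaleDr : right_distributive base_scale +%R.
Proof. by move=> c x y; rewrite /base_scale (scalerDr _ (x : M)). Qed.

Fact base_scaleDl x : {morph base_scale^~ x : c d / c + d}.
Proof. by move=> c d; rewrite /base_scale scalerDl (scalerDl (x : M)). Qed.

HB.instance Definition _ := GRing.Zmodule_isLmodule.Build k (over_base M)
  base_scaleA base_scale1 base_scaleDr base_scaleDl.

Lemma base_scaleE (c : k) (x : over_base M) : c *: x = (c%:A : A) *: (x : M) :> M.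
Proof. by []. Qed.
End OverBase.

Lemma scalar_comm M (c : k) (a : A) (x : M) :
  (c%:A : A) *: (a *: x) = a *: ((c%:A : A) *: x).
Proof. by rewrite !scalerA mulr_algl mulr_algr. Qed.

Lemma base_linear_is_linear M N (f : {linear M -> N}) :
  linear (f : over_base M -> over_base N).
Proof. by move=> c x y; rewrite !base_scaleE; apply: linearP. Qed.

Definition base_linear M N (f : {linear M -> N}) :
    {linear over_base M -> over_base N} :=
  linear_pack (base_linear_is_linear f).

Section BaseHom.
Variables (Q' Q : lmodType A) (d : {linear Q' -> Q}) (N : lmodType A).

(** base_hom is Hom_k(Coker d, N), written as the k-linear maps Q -> N that
vanish on the image of d.  Since k acts through A, k-linearity is stated with
the scalars c%:A.  The left action comes from N and the right action from Q.
With d = 0 this is Hom_k(Q, N). *)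
Definition base_hom_pred : {pred Q -> N} := fun f =>
  `[< (forall (c : k) x y, f ((c%:A : A) *: x + y) = (c%:A : A) *: f x + f y) /\
      forall q, f (d q) = 0 >].

Fact base_hom_submod_closed : submod_closed base_hom_pred.
Proof.
split=> [|a f g /asboolP[fL fd] /asboolP[gL gd]]; apply/asboolP.
  by split=> [c x y|q]; rewrite ?[RHS]addr0 ?scaler0.
split=> [c x y|q]; rewrite -![(_ + _) _]/(_ + _) -![(_ *: _) _]/(_ *: _).
  by rewrite fL gL !scalerDr scalar_comm; apply: addrACA.
by rewrite fd gd scaler0 addr0.
Qed.

HB.instance Definition _ :=
  GRing.isSubmodClosed.Build A (Q -> N) base_hom_pred base_hom_submod_closed.

Record base_hom := BaseHom {
  base_hom_fun :> Q -> N;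
  base_hom_in : base_hom_fun \in base_hom_pred
}.
HB.instance Definition _ := [isSub for base_hom_fun].
HB.instance Definition _ := [Choice of base_hom by <:].
HB.instance Definition _ := [SubChoice_isSubLmodule of base_hom by <:].

Implicit Types f g : base_hom.

Lemma base_hom_linear f (c : k) x y :
  f ((c%:A : A) *: x + y) = (c%:A : A) *: f x + f y.
Proof. by case: f => f /= /asboolP[fL _]; apply: fL. Qed.

Lemma base_hom_kill f q : f (d q) = 0.
Proof. by case: f => f /= /asboolP[_ fd]; apply: fd. Qed.

Lemma base_homD f x y : f (x + y) = f x + f y.
Proof. by have := base_hom_linear f 1 x y; rewrite !scale1r. Qed.

Lemma base_hom_ext f g : f =1 g -> f = g.
Proof. by move=> fg; apply: val_inj; apply: funext. Qed.

Lemma base_hom_scaleE a f q : (a *: f) q = a *: f q. Proof. by []. Qed.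

Fact base_hom_ract_subproof f a : (fun q => f (a *: q)) \in base_hom_pred.
Proof.
apply/asboolP; split=> [c x y|q]; last by rewrite -linearZ base_hom_kill.
by rewrite scalerDr -scalar_comm base_hom_linear.
Qed.

Definition base_hom_ract f a := BaseHom (base_hom_ract_subproof f a).

Fact base_hom_ractDl f g a :
  base_hom_ract (f + g) a = base_hom_ract f a + base_hom_ract g a.
Proof. exact: base_hom_ext. Qed.

Fact base_hom_ractDr f a b :
  base_hom_ract f (a + b) = base_hom_ract f a + base_hom_ract f b.
Proof. by apply: base_hom_ext => q; rewrite /= scalerDl base_homD. Qed.

Fact base_hom_ract1 f : base_hom_ract f 1 = f.
Proof. by apply: base_hom_ext => q; rewrite /= scale1r. Qed.

Fact base_hom_ractM f a b :
  base_hom_ract f (a * b) = base_hom_ract (base_hom_ract f a) b.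
Proof. by apply: base_hom_ext => q; rewrite /= scalerA. Qed.

Fact base_hom_ractZ a f b : base_hom_ract (a *: f) b = a *: base_hom_ract f b.
Proof. exact: base_hom_ext. Qed.

Fact base_hom_ract_central (c : k) f :
  base_hom_ract f (c%:A : A) = (c%:A : A) *: f.
Proof.
apply: base_hom_ext => q; rewrite base_hom_scaleE /=.
have f0 : f 0 = 0 by rewrite -[0 in LHS](linear0 d) base_hom_kill.
by rewrite -[_ *: q]addr0 base_hom_linear f0 addr0.
Qed.

HB.instance Definition _ := Lmodule_isBimodule.Build k A base_hom
  base_hom_ractDl base_hom_ractDr base_hom_ract1 base_hom_ractM base_hom_ractZ
  base_hom_ract_central.
End BaseHom.
Arguments base_hom_pred {Q' Q} d N.

(** * Balanced maps *)

(** The A-linear maps B (x)_A Q -> N, without the tensor product. *)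
Definition balanced B Q N (b : B -> Q -> N) : Prop :=
  [/\ forall q, linear (b^~ q), forall x q q', b x (q + q') = b x q + b x q'
    & forall x a q, b (ract x a) q = b x (a *: q)].

Section Balanced.
Variables (B : bimodType A) (Q N : lmodType A) (b : B -> Q -> N).
Hypothesis b_bal : balanced b.

Lemma balancedDl x y q : b (x + y) q = b x q + b y q.
Proof. by case: b_bal => /(_ q 1 x y); rewrite !scale1r. Qed.

Lemma balancedDr x q r : b x (q + r) = b x q + b x r.
Proof. by case: b_bal. Qed.

Lemma balanced0r x : b x 0 = 0.
Proof. by apply: (addrI (b x 0)); rewrite -balancedDr !addr0. Qed.

Lemma balanced0l q : b 0 q = 0.
Proof. by apply: (addrI (b 0 q)); rewrite -balancedDl !addr0. Qed.

Lemma balancedZ a x q : b (a *: x) q = a *: b x q.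
Proof.
by case: b_bal => /(_ q a x 0) + _ _; rewrite balanced0l !addr0.
Qed.

Lemma balanced_ract x a q : b (ract x a) q = b x (a *: q).
Proof. by case: b_bal. Qed.

Lemma balancedBl x y q : b (x - y) q = b x q - b y q.
Proof. by rewrite -!scaleN1r balancedDl balancedZ. Qed.

(** Balanced maps are k-linear in the second variable because k acts centrally
on bimodules. *)
Lemma balanced_base_scale x (c : k) q :
  b x ((c%:A : A) *: q) = (c%:A : A) *: b x q.
Proof. by rewrite -balanced_ract ract_central balancedZ. Qed.
End Balanced.

Lemma balanced_compl B C Q N (h : {linear B -> C}) (b : C -> Q -> N) :
  right_linear h -> balanced b -> balanced (fun x q => b (h x) q).
Proof.
move=> hr b_bal; split=> [q a x y|x q r|x a q].
- by rewrite linearP (balancedDl b_bal) (balancedZ b_bal).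
- exact: balancedDr.
- by rewrite hr balanced_ract.
Qed.

Lemma balanced_compr B Q X N (h : {linear X -> Q}) (b : B -> Q -> N) :
  balanced b -> balanced (fun x r => b x (h r)).
Proof.
move=> b_bal; split=> [q a x y|x q r|x a q].
- by rewrite (balancedDl b_bal) (balancedZ b_bal).
- by rewrite linearD balancedDr.
- by rewrite linearZ balanced_ract.
Qed.

Lemma balancedB B Q N (b c : B -> Q -> N) :
  balanced b -> balanced c -> balanced (fun x q => b x q - c x q).
Proof.
move=> bb cb; split=> [q a x y|x q r|x a q].
- rewrite (balancedDl bb) (balancedDl cb) (balancedZ bb) (balancedZ cb).
  by rewrite scalerBr opprD addrACA.
- by rewrite (balancedDr bb) (balancedDr cb) opprD addrACA.
- by rewrite (balanced_ract bb) (balanced_ract cb).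
Qed.

(** Left exactness: balanced maps that vanish on Ker f factor through the
quotient C of B. *)
Lemma balanced_descent B C Q N (f : {linear B -> C}) (b : B -> Q -> N) :
    right_linear f -> surj f -> balanced b ->
    (forall x q, f x = 0 -> b x q = 0) ->
  exists2 c : C -> Q -> N, balanced c & forall x q, c (f x) q = b x q.
Proof.
move=> fr /choice[s sK] b_bal kerb; pose c y q := b (s y) q.
have cE x q : c (f x) q = b x q.
  apply/eqP; rewrite -subr_eq0 -(balancedBl b_bal); apply/eqP/kerb.
  by rewrite linearB sK subrr.
exists c => //; split=> [q a x y|y q r|y a q].
- rewrite -{1}(sK x) -{1}(sK y) -linearP cE (balancedDl b_bal).
  by rewrite (balancedZ b_bal).
- by rewrite /c (balancedDr b_bal).
- by rewrite -{1}(sK y) -fr cE balanced_ract.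
Qed.

(** The adjunction Hom_A(B (x)_A Coker d, N) = Hom_(A^e)(B, Hom_k(Coker d, N)),
whose converse direction is balanced_uncurry: it turns the projectivity of the
bimodule B into a property of balanced maps on B. *)
Lemma balanced_curry B Q' Q N (d : {linear Q' -> Q}) (b : B -> Q -> N) :
    balanced b -> (forall x q, b x (d q) = 0) ->
  exists F : {linear B -> base_hom d N},
    right_linear F /\ forall x q, F x q = b x q.
Proof.
move=> b_bal bd.
have bP x : b x \in base_hom_pred d N.
  apply/asboolP; split=> // c q r.
  by rewrite (balancedDr b_bal) (balanced_base_scale b_bal).
pose F x := BaseHom (bP x).
have F_lin : linear F.
  by move=> a x y; apply: base_hom_ext => q /=; case: b_bal => /(_ q a x y).
exists (linear_pack F_lin).
by split=> // x a; apply: base_hom_ext => q; rewrite /= (balanced_ract b_bal).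
Qed.

Lemma balanced_uncurry B Q' Q N (d : {linear Q' -> Q})
    (F : {linear B -> base_hom d N}) :
  right_linear F -> balanced (fun x q => F x q).
Proof.
move=> Fr; split=> [q a x y|x q r|x a q]; first by rewrite linearP.
- exact: base_homD.
- by rewrite Fr.
Qed.

(** Under the adjunction, c is a lift of b along the bimodule map
Hom_k(Q0, N) -> Hom_k(Coker d2, N), precomposition with d1.  It is surjective:
exactness embeds Coker d2 into Q0, and k-linear maps extend from subspaces. *)
Lemma projective_balanced_extension P Q2 Q1 Q0 N
    (d2 : {linear Q2 -> Q1}) (d1 : {linear Q1 -> Q0}) (b : P -> Q1 -> N) :
    bimod_projective P ->
    (forall q, d1 q = 0 <-> exists r, d2 r = q) ->
    balanced b -> (forall x r, b x (d2 r) = 0) ->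
  exists2 c : P -> Q0 -> N, balanced c & forall x q, c x (d1 q) = b x q.
Proof.
move=> Pproj exact1 b_bal bd2.
have [F [Fr FE]] := balanced_curry b_bal bd2.
(* With d = zero0, base_hom is Hom_k(Q0, N). *)
pose zero0 : {linear Q0 -> Q0} := \0.
have precompP (f : base_hom zero0 N) : f \o d1 \in base_hom_pred d2 N.
  apply/asboolP; split=> [c x y|q] /=.
    by rewrite linearP base_hom_linear.
  have -> : d1 (d2 q) = 0 by apply/exact1; exists q.
  exact: (base_hom_kill f 0).
pose G (f : base_hom zero0 N) := BaseHom (precompP f).
have G_lin : linear G by move=> a f g; apply: base_hom_ext.
have [||H [Hr HE]] := Pproj _ _ (linear_pack G_lin) F _ Fr.
- by move=> f a; apply: base_hom_ext => q /=; rewrite linearZ.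
- move=> f; have f_lin : linear (f : over_base Q1 -> over_base N).
    by move=> c x y; apply: base_hom_linear.
  have [q /exact1[r <-]|g gE] :=
      linear_extension (d := base_linear d1) (f := linear_pack f_lin).
    exact: base_hom_kill.
  have gP : (g : Q0 -> N) \in base_hom_pred zero0 N.
    by apply/asboolP; split=> [c x y|q]; [apply: (linearP g) | apply: (linear0 g)].
  by exists (BaseHom gP); apply: base_hom_ext => q; apply: gE.
exists (fun x q => H x q); first exact: balanced_uncurry.
by move=> x q; rewrite -FE -HE.
Qed.

(** Hom_A(P, X) = Hom_(A^e)(P, Hom_k(A, X)), and Hom_k(A, -) preserves
surjections since they split over k. *)
Lemma bimod_projective_left_projective P : bimod_projective P -> projective P.
Proof.
move=> Pproj X Y g f g_surj.
pose zeroA : {linear A^o -> A^o} := \0.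
have postP (h : base_hom zeroA X) : g \o h \in base_hom_pred zeroA Y.
  apply/asboolP; split=> [c x y|q] /=.
    by rewrite base_hom_linear linearP.
  by rewrite (base_hom_kill h 0) linear0.
pose G (h : base_hom zeroA X) := BaseHom (postP h).
have G_lin : linear G.
  by move=> a h h'; apply: base_hom_ext => q; apply: linearP.
pose b (x : P) (a : A^o) := f (ract x a).
have b_bal : balanced b.
  rewrite /b; split=> [q a x y|x q r|x a q].
  - by rewrite ractDl ractZ linearP.
  - by rewrite ractDr linearD.
  - by rewrite -ractM.
have b0 x q : b x (zeroA q) = 0 by apply: (balanced0r b_bal).
have [F [Fr FE]] := balanced_curry b_bal b0.
have [||H [Hr HE]] := Pproj _ _ (linear_pack G_lin) F _ Fr.
- by move=> h a; apply: base_hom_ext.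
- move=> h; have gb_surj : surj (base_linear g) by apply: g_surj.
  have [s sK] := linear_section gb_surj.
  have shP : (fun q => s (h q) : X) \in base_hom_pred zeroA X.
    apply/asboolP; split=> [c x y|q].
      by rewrite base_hom_linear; apply: (linearP s).
    by rewrite (base_hom_kill h 0); apply: (linear0 s).
  by exists (BaseHom shP); apply: base_hom_ext => q; apply: sK.
have H_lin : linear (fun x => H x (1 : A^o)) by move=> a x y; rewrite linearP.
exists (linear_pack H_lin) => x.
by rewrite -[x in RHS]ract1 -[RHS]/(b x 1) -FE -HE.
Qed.

(** * Left modules of A-linear maps *)

Section LeftHom.
Variables (B : bimodType A) (N : lmodType A).

(** left_hom is Hom_A(B, N); it is a left module through the right action of A
on B. *)
Definition left_hom_pred : {pred B -> N} := fun f => `[< linear f >].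

Fact left_hom_zmod_closed : zmod_closed left_hom_pred.
Proof.
split=> [|f g /asboolP fL /asboolP gL]; apply/asboolP => a x y.
  by rewrite [RHS]addr0 scaler0.
rewrite -![(_ + _) _]/(_ + _) -![(- g) _]/(- g _).
by rewrite fL gL scalerBr opprD; apply: addrACA.
Qed.

HB.instance Definition _ :=
  GRing.isZmodClosed.Build (B -> N) left_hom_pred left_hom_zmod_closed.

Record left_hom := LeftHom {
  left_hom_fun :> B -> N;
  left_hom_in : left_hom_fun \in left_hom_pred
}.
HB.instance Definition _ := [isSub for left_hom_fun].
HB.instance Definition _ := [Choice of left_hom by <:].
HB.instance Definition _ := [SubChoice_isSubZmodule of left_hom by <:].

Implicit Types f g : left_hom.

Lemma left_hom_linear f : linear f.
Proof. by case: f => f /= /asboolP. Qed.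

Lemma left_homD f x y : f (x + y) = f x + f y.
Proof. by have := left_hom_linear f 1 x y; rewrite !scale1r. Qed.

Lemma left_hom_ext f g : f =1 g -> f = g.
Proof. by move=> fg; apply: val_inj; apply: funext. Qed.

Fact left_hom_scale_subproof (a : A) f : (fun x => f (ract x a)) \in left_hom_pred.
Proof. by apply/asboolP => b x y; rewrite ractDl ractZ left_hom_linear. Qed.

Definition left_hom_scale a f := LeftHom (left_hom_scale_subproof a f).

Fact left_hom_scaleA a b f :
  left_hom_scale a (left_hom_scale b f) = left_hom_scale (a * b) f.
Proof. by apply: left_hom_ext => x; rewrite /= ractM. Qed.

Fact left_hom_scale1 : left_id 1 left_hom_scale.
Proof. by move=> f; apply: left_hom_ext => x; rewrite /= ract1. Qed.

Fact left_hom_scaleDr : right_distributive left_hom_scale +%R.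
Proof. by move=> a f g; apply: left_hom_ext. Qed.

Fact left_hom_scaleDl f : {morph left_hom_scale^~ f : a b / a + b}.
Proof.
by move=> a b; apply: left_hom_ext => x; rewrite /= ractDr left_homD.
Qed.

HB.instance Definition _ := GRing.Zmodule_isLmodule.Build A left_hom
  left_hom_scaleA left_hom_scale1 left_hom_scaleDr left_hom_scaleDl.
End LeftHom.
Arguments left_hom_pred B N : clear implicits.

(** The adjunction Hom_A(K (x)_A Q, N) = Hom_A(Q, Hom_A(K, N)) makes c a lift
of b along the restriction map Hom_A(P, N) -> Hom_A(K, N), which is surjective
because composition with r is a section of it.  The retraction r is only
left linear, so b o r is not balanced in general and Q has to be projective. *)
Lemma left_split_balanced_extension K P Q N (j : {linear K -> P})
    (r : {linear P -> K}) (b : K -> Q -> N) :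
    projective Q -> right_linear j -> cancel j r -> balanced b ->
  exists2 c : P -> Q -> N, balanced c & forall x q, c (j x) q = b x q.
Proof.
move=> Qproj jr rK b_bal.
have restrP (f : left_hom P N) : f \o j \in left_hom_pred K N.
  by apply/asboolP => a x y; rewrite /= linearP left_hom_linear.
pose G f := LeftHom (restrP f).
have G_lin : linear G.
  move=> a f g; apply: left_hom_ext => x.
  by rewrite -[RHS]/(f (j (ract x a)) + g (j x)) jr.
have bP q : b^~ q \in left_hom_pred K N.
  by apply/asboolP; case: b_bal.
pose F q := LeftHom (bP q).
have F_lin : linear F.
  move=> a q q'; apply: left_hom_ext => x.
  by rewrite /= (balancedDr b_bal) -(balanced_ract b_bal).
have [f|H HE] := Qproj _ _ (linear_pack G_lin) (linear_pack F_lin).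
  have fP : f \o r \in left_hom_pred P N.
    by apply/asboolP => a x y; rewrite /= linearP left_hom_linear.
  by exists (LeftHom fP); apply: left_hom_ext => x; rewrite /= rK.
exists (fun x q => H q x).
  split=> [q|x q q'|x a q]; first exact: left_hom_linear.
  - by rewrite linearD.
  - by rewrite linearZ.
by move=> x q; rewrite -[LHS]/(linear_pack G_lin (H q) x) HE.
Qed.

(** * Syzygies and dimension shifting *)

Lemma regular_projective : projective (A^o : lmodType A).
Proof.
move=> X Y g f /(_ (f 1))[x gx].
have h_lin : linear (fun a : A^o => (a : A) *: x).
  by move=> a b c; rewrite scalerDl scalerA.
exists (linear_pack h_lin) => a /=.
by rewrite linearZ gx -linearZ /= [_ *: _]mulr1.
Qed.

Lemma retract_projective X Y (j : {linear X -> Y}) (r : {linear Y -> X}) :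
  cancel j r -> projective Y -> projective X.
Proof.
move=> rK Yproj U V g f /(Yproj U V g (f \o r))[h hE].
by exists (h \o j) => x; rewrite /= hE /= rK.
Qed.

(** A left-linear section s of f splits the sequence; the retraction maps x to
x - s (f x), which lies in the kernel. *)
Lemma left_split_kernel K P L (f : {linear P -> L}) (j : {linear K -> P}) :
    projective L -> surj f -> injective j ->
    (forall x, f x = 0 <-> exists y, j y = x) ->
  exists r : {linear P -> K}, cancel j r.
Proof.
move=> Lproj f_surj j_inj exactP.
have [s sK] := Lproj _ _ f idfun f_surj.
have [|x y y'|a x x' y y' jy jy'|r rE] :=
    @linear_of_graph A P K (fun x y => j y = x - s (f x)).
- by move=> x; apply/exactP; rewrite linearB sK subrr.
- by move=> <- /j_inj.
- rewrite linearP jy jy' [f (_ + _)]linearP [s (_ + _)]linearP.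
  by rewrite scalerBr opprD addrACA.
exists r => y; apply: j_inj; rewrite rE.
have -> : f (j y) = 0 by apply/exactP; exists y.
by rewrite linear0 subr0.
Qed.

Lemma syzygy_left_projective L K : is_syzygy L K -> projective L -> projective K.
Proof.
move=> [P [f [j [[Pproj _ f_surj _] _ j_inj exactP]]]] Lproj.
have [r rK] := left_split_kernel Lproj f_surj j_inj exactP.
exact: retract_projective rK (bimod_projective_left_projective Pproj).
Qed.

Lemma bimod_iso_inv B C : bimod_iso B C ->
  exists (f : {linear B -> C}) (g : {linear C -> B}),
    [/\ right_linear f, right_linear g, cancel f g & cancel g f].
Proof.
move=> [f [fr [g gK fK]]].
have g_lin : linear g.
  by move=> a x y; apply: (can_inj gK); rewrite linearP !fK.
exists f, (linear_pack g_lin); split=> // x a.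
by apply: (can_inj gK); rewrite fr /= !fK.
Qed.

Lemma bimod_iso_sym B C : bimod_iso B C -> bimod_iso C B.
Proof.
by move=> /bimod_iso_inv[f [g [fr gr gK fK]]]; exists g; split=> //; exists f.
Qed.

Lemma bimod_iso_trans B C D : bimod_iso B C -> bimod_iso C D -> bimod_iso B D.
Proof.
move=> [f [fr fb]] [g [gr gb]]; exists (g \o f); split; last exact: bij_comp.
by move=> x a; rewrite /= fr gr.
Qed.

Lemma bimod_iso_left_projective B C : bimod_iso B C -> projective B -> projective C.
Proof. by move=> /bimod_iso_inv[f [g [_ _ _ /retract_projective]]]; apply. Qed.

Section DimensionShift.
Variables (M N : lmodType A) (Q : projective_resolution M).
Implicit Types n i : nat.

(** Vanishing of H^(i+1) of the complex of balanced maps from B and Q to N, that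
is, of Ext_A^(i+1)(M, N) when B = A. *)
Definition balanced_exact B i : Prop :=
  forall b : B -> Q i.+1 -> N, balanced b ->
    (forall x q, b x (res_d Q i.+1 q) = 0) ->
  exists2 c : B -> Q i -> N, balanced c & forall x q, c x (res_d Q i q) = b x q.

Lemma res_dd i q : res_d Q i (res_d Q i.+1 q) = 0.
Proof. by apply/res_d_exact; exists q. Qed.

Lemma balanced_exact_iso B C i :
  bimod_iso B C -> balanced_exact B i <-> balanced_exact C i.
Proof.
suff imp B' C' : bimod_iso B' C' -> balanced_exact B' i -> balanced_exact C' i.
  by move=> BC; split; apply: imp => //; apply: bimod_iso_sym.
move=> /bimod_iso_inv[f [g [fr gr gK fK]]] exB b b_bal bd.
have [|c c_bal cE] := exB _ (balanced_compl fr b_bal); first by move=> x q.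
exists (fun x q => c (g x) q); first exact: balanced_compl.
by move=> x q; rewrite cE fK.
Qed.

(** Balanced maps on 0 -> K -> P -> L -> 0 against Q give a short exact sequence
of complexes, exact on the right because K -> P splits on the left, and the
complex of P has no cohomology in positive degrees; this is the connecting
isomorphism, reduced to the vanishing of its two sides. *)
Lemma balanced_exact_shift L K i : is_syzygy L K -> projective L ->
  balanced_exact L i.+1 <-> balanced_exact K i.
Proof.
move=> [P [f [j [[Pproj fr f_surj _] jr j_inj exactP]]]] Lproj.
have [r rK] := left_split_kernel Lproj f_surj j_inj exactP.
have fj y : f (j y) = 0 by apply/exactP; exists y.
split=> exB b b_bal bd.
- (* A cocycle b on K extends to c on P.  The differential of c descends to a
     cocycle e on L, which bounds some g; subtracting g makes c a cocycle on P,
     and it bounds there. *)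
  have [c c_bal cE] :=
    left_split_balanced_extension (@res_projective _ _ Q i.+1) jr rK b_bal.
  have cd_bal := balanced_compr (res_d Q i.+1) c_bal.
  have [|e e_bal eE] := balanced_descent fr f_surj cd_bal.
    by move=> _ q /exactP[y <-]; rewrite cE bd.
  have [|g g_bal gE] := exB e e_bal.
    by move=> y q; have [x <-] := f_surj y; rewrite eE res_dd (balanced0r c_bal).
  have h_bal := balancedB c_bal (balanced_compl fr g_bal).
  have [|h' h'_bal h'E] :=
      projective_balanced_extension Pproj (@res_d_exact _ _ Q i) h_bal.
    by move=> x q; rewrite gE eE subrr.
  exists (fun y q => h' (j y) q); first exact: balanced_compl.
  by move=> y q; rewrite h'E cE fj (balanced0l g_bal) subr0.
- (* A cocycle b on L, pulled back to P, bounds some c.  The restriction of c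
     to K is a cocycle, so it bounds some e, which extends to g on P;
     subtracting the differential of g makes c descend to L. *)
  have bf_bal := balanced_compl fr b_bal.
  have [|c c_bal cE] :=
      projective_balanced_extension Pproj (@res_d_exact _ _ Q i.+1) bf_bal.
    by move=> x q.
  have [|e e_bal eE] := exB _ (balanced_compl jr c_bal).
    by move=> y q; rewrite cE fj (balanced0l b_bal).
  have [g g_bal gE] :=
    left_split_balanced_extension (@res_projective _ _ Q i) jr rK e_bal.
  have h_bal := balancedB c_bal (balanced_compr (res_d Q i) g_bal).
  have [|h' h'_bal h'E] := balanced_descent fr f_surj h_bal.
    by move=> _ q /exactP[y <-]; rewrite gE eE subrr.
  exists h' => // y q; have [x <-] := f_surj y.
  by rewrite h'E cE res_dd (balanced0r g_bal) subr0.
Qed.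

Lemma balanced_exact_nth_syzygy n B K i : is_nth_syzygy n B K -> projective B ->
  projective K /\ (balanced_exact B (i + n) <-> balanced_exact K i).
Proof.
elim: n => [|n IHn] /= in K i *.
  move=> BK Bp; rewrite addn0; split; last exact: balanced_exact_iso.
  exact: bimod_iso_left_projective BK Bp.
move=> [L [BL LK]] Bp; have [Lp IH] := IHn L i.+1 BL Bp.
split; first exact: syzygy_left_projective LK Lp.
by rewrite addnS -addSn IH; apply: balanced_exact_shift.
Qed.

(** A balanced map b on A and Q is determined by the linear map b 1, as
A (x)_A Q = Q. *)
Lemma balanced_exact_regular i : balanced_exact (A^o : bimodType A) i <->
  forall f : {linear Q i.+1 -> N}, cocycle f -> coboundary f.
Proof.
split=> [exA f fd|exN b b_bal bd].
  pose b (a : A^o) q := (a : A) *: f q.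
  have b_bal : balanced b.
    split=> [q a x y|x q r|x a q]; rewrite /b.
    - by rewrite scalerDl scalerA.
    - by rewrite linearD scalerDr.
    - by rewrite linearZ /= scalerA.
  have [|c c_bal cE] := exA b b_bal; first by move=> x q; rewrite /b fd scaler0.
  have c_lin : linear (c 1).
    move=> a x y; rewrite (balancedDr c_bal) -(balanced_ract c_bal).
    by rewrite -(balancedZ c_bal) [ract _ _]mul1r [_ *: _]mulr1.
  by exists (linear_pack c_lin) => x; rewrite /= cE /b scale1r.
have b_lin : linear (b 1).
  move=> a x y; rewrite (balancedDr b_bal) -(balanced_ract b_bal).
  by rewrite -(balancedZ b_bal) [ract _ _]mul1r [_ *: _]mulr1.
have [|g gE] := exN (linear_pack b_lin); first exact: bd.
exists (fun a q => (a : A) *: g q).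
  split=> [q a x y|x q r|x a q].
  - by rewrite scalerDl scalerA.
  - by rewrite linearD scalerDr.
  - by rewrite linearZ /= scalerA.
by move=> a q; rewrite -gE /= -(balancedZ b_bal) [_ *: _]mulr1.
Qed.
End DimensionShift.

(** The bound is the index n of the periodic syzygy.  Ext is descended in steps
of p from an index where it vanishes by assumption, with the resolution Q that
witnesses the vanishing there. *)
Lemma eventually_periodic_AC : eventually_periodic_algebra A -> satisfies_AC A.
Proof.
move=> [n [K [AK [p [K' [p_gt0 KK' K'K]]]]]] M _; exists n => N _ [m Extm] i n_lt_i.
have [t le_m] : exists t, (m <= i + t * p)%N.
  by exists m; rewrite (leq_trans (leq_pmulr m p_gt0)) ?leq_addl.
have [Q exQ] := Extm _ le_m; exists Q.
case: i n_lt_i le_m exQ => // i; rewrite ltnS => n_le_i _ exQ.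
apply/(@balanced_exact_regular M N Q i).
have {exQ} : balanced_exact N Q A^o (i + t * p).
  by apply/(@balanced_exact_regular M N Q).
elim: t => [|t IHt]; first by rewrite addn0.
rewrite mulSn addnCA addnC => exA; apply: IHt; move: exA.
rewrite -(subnK (leq_trans n_le_i (leq_addr (t * p) i))).
set l := (_ - _)%N; rewrite addnAC => exA.
have Ap := regular_projective.
have [Kp AKl] := balanced_exact_nth_syzygy N Q l AK Ap.
have [_ AKlp] := balanced_exact_nth_syzygy N Q (l + p) AK Ap.
have [_ KK'l] := balanced_exact_nth_syzygy N Q l KK' Kp.
apply/AKl/(balanced_exact_iso N Q l K'K)/KK'l/AKlp.
exact: exA.
Qed.
End Bimodules.

(** * Exchanging the two actions *)

Section AntiIsomorphism.
Variables (k : fieldType) (A A' : algType k).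

Definition anti_morphism (s : A -> A') : Prop :=
  [/\ forall a b, s (a + b) = s a + s b, s 1 = 1,
      forall a b, s (a * b) = s b * s a & forall c : k, s c%:A = c%:A].

(** The bimodule over A got from one over A' by exchanging the two actions along
s.  An anti-isomorphism is used, and not only the opposite algebra, so that the
construction can be inverted: the opposite of the opposite of A has the same
operations as A, but is not the same structure. *)
Definition twist (s : A -> A') (_ : anti_morphism s) (B : bimodType A') : Type := B.

Section Twist.
Variables (s : A -> A') (s_anti : anti_morphism s) (B : bimodType A').

HB.instance Definition _ := GRing.Zmodule.on (twist s_anti B).

Let twist_scale (a : A) (x : twist s_anti B) : twist s_anti B :=
  ract (x : B) (s a).

Fact twist_scaleA a b x : twist_scale a (twist_scale b x) = twist_scale (a * b) x.
Proof. by have [_ _ sM _] := s_anti; rewrite /twist_scale sM ractM. Qed.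

Fact twist_scale1 : left_id 1 twist_scale.
Proof. by move=> x; have [_ s1 _ _] := s_anti; rewrite /twist_scale s1 ract1. Qed.

Fact twist_scaleDr : right_distributive twist_scale +%R.
Proof. by move=> a x y; apply: (@ractDl k A' B). Qed.

Fact twist_scaleDl x : {morph twist_scale^~ x : a b / a + b}.
Proof.
move=> a b; have [sD _ _ _] := s_anti.
by rewrite /twist_scale sD; apply: (@ractDr k A' B).
Qed.

HB.instance Definition _ := GRing.Zmodule_isLmodule.Build A (twist s_anti B)
  twist_scaleA twist_scale1 twist_scaleDr twist_scaleDl.

Let twist_ract (x : twist s_anti B) (a : A) : twist s_anti B := s a *: (x : B).

Fact twist_ractDl x y a : twist_ract (x + y) a = twist_ract x a + twist_ract y a.
Proof. exact: (@scalerDr A' B). Qed.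

Fact twist_ractDr x a b : twist_ract x (a + b) = twist_ract x a + twist_ract x b.
Proof.
by have [sD _ _ _] := s_anti; rewrite /twist_ract sD; apply: (@scalerDl A' B).
Qed.

Fact twist_ract1 x : twist_ract x 1 = x.
Proof. by have [_ s1 _ _] := s_anti; rewrite /twist_ract s1 (scale1r (x : B)). Qed.

Fact twist_ractM x a b : twist_ract x (a * b) = twist_ract (twist_ract x a) b.
Proof.
by have [_ _ sM _] := s_anti; rewrite /twist_ract sM (scalerA _ _ (x : B)).
Qed.

Fact twist_ractZ a x b : twist_ract (a *: x) b = a *: twist_ract x b.
Proof. exact: esym (@ractZ k A' B _ _ _). Qed.

Fact twist_ract_central (c : k) x : twist_ract x (c%:A : A) = (c%:A : A) *: x.
Proof.
have [_ _ _ sc] := s_anti; rewrite -[RHS]/(ract (x : B) (s (c%:A : A))).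
by rewrite /twist_ract sc ract_central.
Qed.

HB.instance Definition _ := Lmodule_isBimodule.Build k A (twist s_anti B)
  twist_ractDl twist_ractDr twist_ract1 twist_ractM twist_ractZ
  twist_ract_central.

Lemma twist_scaleE a (x : B) :
  a *: (x : twist s_anti B) = ract x (s a) :> B.
Proof. by []. Qed.

Lemma twist_ractE a (x : B) :
  ract (x : twist s_anti B) a = s a *: x :> B.
Proof. by []. Qed.
End Twist.

Lemma twist_map (s : A -> A') (s_anti : anti_morphism s) (B C : bimodType A')
    (f : {linear B -> C}) : right_linear f ->
  exists2 f' : {linear twist s_anti B -> twist s_anti C},
    right_linear f' & forall x, f' x = f x.
Proof.
move=> fr; have f_lin : linear (f : twist s_anti B -> twist s_anti C).
  by move=> a x y; rewrite !twist_scaleE linearD fr.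
by exists (linear_pack f_lin) => // x a; apply: linearZ.
Qed.
End AntiIsomorphism.

Section Transport.
Variables (k : fieldType) (A A' : algType k) (s : A -> A') (t : A' -> A).
Hypotheses (s_anti : anti_morphism s) (t_anti : anti_morphism t).
Hypotheses (sK : cancel s t) (tK : cancel t s).
Local Notation tw := (twist s_anti).

(** A lifting problem for tw P over A becomes, after twisting its target by t, a
lifting problem for P over A'. *)
Lemma twist_projective (P : bimodType A') :
  bimod_projective P -> bimod_projective (tw P).
Proof.
move=> Pproj X Y g f gr fr g_surj.
have [g' g'r g'E] := twist_map t_anti gr.
have f_lin : linear (f : P -> twist t_anti Y).
  move=> a x y; rewrite -[a in LHS]tK twist_scaleE -fr.
  exact: linearD.
have [||h [hr hE]] := Pproj _ _ g' (linear_pack f_lin) g'r.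
- move=> x a; rewrite /= -[a in LHS]tK.
  by rewrite -[LHS]/(f (t a *: (x : tw P))) linearZ.
- by move=> y; have [x <-] := g_surj y; exists x.
have h_lin : linear (h : tw P -> X).
  move=> a x y; rewrite -[a in RHS]sK.
  rewrite -[LHS]/(h (ract (x : P) (s a) + y)) linearD hr.
  by [].
exists (linear_pack h_lin); split=> [x a|x]; last by rewrite /= -g'E hE.
rewrite -[LHS]/(h (s a *: (x : P))) linearZ -[a in RHS]sK.
by [].
Qed.

Lemma twist_syzygy (B K : bimodType A') : is_syzygy B K -> is_syzygy (tw B) (tw K).
Proof.
move=> [P [f [j [[Pproj fr f_surj f_cover] jr j_inj exactP]]]].
have [f' f'r f'E] := twist_map s_anti fr.
have [j' j'r j'E] := twist_map s_anti jr.
exists (tw P), f', j'; split=> //.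
- split=> //; first exact: twist_projective.
    by move=> y; have [x <-] := f_surj y; exists x; rewrite f'E.
  move=> U [U0 UD UZ Ur] Usum; apply: f_cover => [|x].
    split=> // [a x Ux|x a Ux].
      by have := Ur x (t a) Ux; rewrite twist_ractE tK.
    by have := UZ (t a) x Ux; rewrite twist_scaleE tK.
  by have [u [v [Uu fv ->]]] := Usum x; exists u, v; rewrite -f'E.
- by move=> x y; rewrite !j'E; apply: j_inj.
move=> x; rewrite f'E; split=> [/exactP[y <-]|[y <-]]; first by exists y.
by rewrite j'E; apply/exactP; exists y.
Qed.

Lemma twist_iso (B C : bimodType A') : bimod_iso B C -> bimod_iso (tw B) (tw C).
Proof.
move=> [f [fr fb]]; have [f' f'r f'E] := twist_map s_anti fr.
have [g fK gK] := fb; exists f'; split=> //.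
by exists g => x; rewrite f'E ?fK ?gK.
Qed.

Lemma twist_nth_syzygy n (B K : bimodType A') :
  is_nth_syzygy n B K -> is_nth_syzygy n (tw B) (tw K).
Proof.
elim: n K => [|n IHn] K /=; first exact: twist_iso.
by move=> [L [/IHn BL /twist_syzygy LK]]; exists (tw L).
Qed.

(** The isomorphism is s, which exchanges left and right multiplication. *)
Lemma regular_twist_iso : bimod_iso (A^o : bimodType A) (tw A'^o).
Proof.
have [sD s1 sM _] := s_anti.
have s_lin : linear (s : A^o -> tw A'^o).
  by move=> a x y; rewrite sD sM.
exists (linear_pack s_lin); split; last by exists t.
by move=> x a; apply: sM.
Qed.

Lemma nth_syzygy_isol n (B C K : bimodType A) :
  bimod_iso B C -> is_nth_syzygy n C K -> is_nth_syzygy n B K.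
Proof.
move=> BC; elim: n K => [|n IHn] K /=; first exact: bimod_iso_trans.
by move=> [L [/IHn BL LK]]; exists L.
Qed.

Lemma eventually_periodic_anti :
  eventually_periodic_algebra A' -> eventually_periodic_algebra A.
Proof.
move=> [n [K [AK [p [K' [p_gt0 KK' K'K]]]]]]; exists n, (tw K); split.
  exact: nth_syzygy_isol regular_twist_iso (twist_nth_syzygy AK).
by exists p, (tw K'); split; [|apply: twist_nth_syzygy|apply: twist_iso].
Qed.
End Transport.

(** * The opposite algebra *)

Section Opposite.
Variables (k : fieldType) (A : algType k).

Let op_scale (c : k) (a : A^c) : A^c := c *: (a : A).

Fact op_scaleA c d a : op_scale c (op_scale d a) = op_scale (c * d) a.
Proof. exact: (@scalerA k A). Qed.
Fact op_scale1 : left_id 1 op_scale.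
Proof. exact: (@scale1r k A). Qed.
Fact op_scaleDr : right_distributive op_scale +%R.
Proof. exact: (@scalerDr k A). Qed.
Fact op_scaleDl a : {morph op_scale^~ a : c d / c + d}.
Proof. by move=> c d; apply: (@scalerDl k A). Qed.

HB.instance Definition _ := GRing.Zmodule_isLmodule.Build k A^c
  op_scaleA op_scale1 op_scaleDr op_scaleDl.

Fact op_scaleAl (c : k) (a b : A^c) : c *: (a * b) = (c *: a) * b.
Proof. exact: (@scalerAr k A). Qed.
HB.instance Definition _ := GRing.Lmodule_isLalgebra.Build k A^c op_scaleAl.
Fact op_scaleAr (c : k) (a b : A^c) : c *: (a * b) = a * (c *: b).
Proof. exact: (@scalerAl k A). Qed.
HB.instance Definition _ := GRing.Lalgebra_isAlgebra.Build k A^c op_scaleAr.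
End Opposite.

Theorem proposition5p6 (k : fieldType) (Lambda : falgType k)
  (hLambda : eventually_periodic_algebra Lambda) :
  satisfies_AC Lambda /\ satisfies_AC Lambda^c.
Proof.
split; first exact: eventually_periodic_AC hLambda.
pose op : algType k := Lambda^c.
apply: (@eventually_periodic_AC k op).
by apply: (@eventually_periodic_anti k op Lambda id id) => //; split.
Qed.
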